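(* Let $\mathcal{P}$ be a homogeneous PSD-stable linear principal minor (lpm) polynomial of degree $k$ on the space $\mathbb{S}_n$ of $n\times n$ real symmetric matrices (hence hyperbolic with respect to the identity matrix $I_n$), with hyperbolicity cone $H(\mathcal{P})$, and let $\Pi$ be a partition of $[n]=\{1,\dots,n\}$. Then for every $A\in H(\mathcal{P})$, $$\pi_\Pi(A)\in H(\mathcal{P})\qquad\text{and}\qquad \mathcal{P}(\pi_\Pi(A))\ge\mathcal{P}(A).$$
   Context: For a symmetric $n\times n$ matrix $X$ and $J\subseteq[n]$, $X_J$ denotes the principal submatrix indexed by $J$ (with $\det X_\emptyset=1$). An lpm polynomial is a polynomial of the form $\mathcal{P}(X)=\sum_{J\subseteq[n]}c_J\det(X_J)$ with real coefficients $c_J$. A homogeneous real polynomial $\mathcal{P}$ of degree $k$ on $\mathbb{S}_n$ is hyperbolic with respect to $I_n$ if $\mathcal{P}(I_n)>0$ and, for every $A\in\mathbb{S}_n$, the univariate polynomial $t\mapsto\mathcal{P}(tI_n+A)$ has only real zeros. Then $\mathcal{P}(tI_n+A)=\mathcal{P}(I_n)\prod_{i=1}^k(t+\lambda_i(\mathcal{P};I_n,A))$ with real $\lambda_i(\mathcal{P};I_n,A)$. The term PSD-stable is used here to mean hyperbolic with respect to $I_n$. The hyperbolicity cone is $H(\mathcal{P})=\{A\in\mathbb{S}_n:\lambda_i(\mathcal{P};I_n,A)>0\text{ for all }i=1,\dots,k\}$. For a partition $\Pi=\{S_1,\dots,S_m\}$ of $[n]$, $\pi_\Pi:\mathbb{S}_n\to\mathbb{S}_n$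 is the block-diagonal pinching: $\pi_\Pi(A)$ has the same $(i,j)$ entry as $A$ if $i,j$ lie in the same block of $\Pi$, and $(i,j)$ entry $0$ otherwise. *)

(* Defs.v *)
From mathcomp Require Import all_boot all_order all_algebra.
From mathcomp Require Import reals.
From mathcomp.real_closed Require Import complex.

Set Implicit Arguments.
Unset Strict Implicit.
Unset Printing Implicit Defensive.

Import Order.TTheory GRing.Theory Num.Theory.
Local Open Scope ring_scope.

(* A real polynomial on the space of symmetric matrices is represented by its
   polynomial function; its values at non-symmetric matrices are irrelevant to
   every definition below. *)

Definition principal_submx (R : Type) (n : nat) (J : {set 'I_n})
    (X : 'M[R]_n) : 'M[R]_#|J| :=
  mxsub (@enum_val _ (mem J)) (@enum_val _ (mem J)) X.

Definition lpm_polynomial (R : realType) (n : nat) (P : 'M[R]_n -> R) : Prop :=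
  exists c : {set 'I_n} -> R, forall X : 'M[R]_n, X \is symmetricmx ->
    P X = \sum_(J : {set 'I_n}) c J * \det (principal_submx J X).

Definition homogeneous (R : realType) (n k : nat) (P : 'M[R]_n -> R) : Prop :=
  forall (a : R) (X : 'M[R]_n), X \is symmetricmx -> P (a *: X) = a ^+ k * P X.

Definition only_real_zeros (R : realType) (p : {poly R}) : Prop :=
  forall z : R[i], root (map_poly (real_complex R) p) z -> z \is Num.real.

(* Hyperbolicity with respect to the identity matrix. R being infinite, the
   polynomial p representing t |-> P (t I + A) is unique; it exists as soon as P
   is a polynomial function. *)
Definition hyperbolic (R : realType) (n : nat) (P : 'M[R]_n -> R) : Prop :=
  0 < P 1%:M /\
  forall A : 'M[R]_n, A \is symmetricmx ->
    exists p : {poly R},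
      (forall t : R, p.[t] = P (t%:M + A)) /\ only_real_zeros p.

(* The family lam is determined by P and A up to the order of its members, so
   "there is such a family with positive members" in hyperbolicity_cone means
   that all the eigenvalues of A are positive. *)
Definition hyperbolic_eigenvalues (R : realType) (n k : nat)
    (P : 'M[R]_n -> R) (A : 'M[R]_n) (lam : 'I_k -> R) : Prop :=
  forall t : R, P (t%:M + A) = P 1%:M * \prod_(i < k) (t + lam i).

Definition hyperbolicity_cone (R : realType) (n k : nat) (P : 'M[R]_n -> R)
    (A : 'M[R]_n) : Prop :=
  A \is symmetricmx /\
  exists lam : 'I_k -> R,
    hyperbolic_eigenvalues P A lam /\ forall i, 0 < lam i.

Definition pinching (R : realType) (n : nat) (Pi : {set {set 'I_n}})
    (A : 'M[R]_n) : 'M[R]_n :=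
  \matrix_(i < n, j < n)
    if [exists S in Pi, (i \in S) && (j \in S)] then A i j else 0.

(* Main.v *)
Require Import Defs.
From mathcomp Require Import all_boot all_order all_algebra.
From mathcomp Require Import reals.
From mathcomp Require classical_sets.
From mathcomp Require Import ring lra.
From mathcomp.real_closed Require Import complex.

(** Conjugation by a diagonal matrix of signs leaves every principal minor
    unchanged, hence leaves P and its hyperbolicity cone unchanged. If S is one
    block of the partition and B is A conjugated by the signs that are negative
    exactly on S, then (A + B) / 2 is A with the entries between S and its
    complement erased; doing this for all blocks of the partition in turn
    produces the pinching ([pinching_foldr]). So it is enough to know, for two
    members A, B of the cone, that their midpoint M lies in the cone and that
    P(A) P(B) <= P(M)^2 ([hlpm_cone_midpoint]): here P(B) = P(A), so this reads
    P(A) <= P(M).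

    The midpoint property is a piece of Garding's theory of hyperbolic
    polynomials. All of it follows from one zero-free region for the complex
    extension of P: P(zI + wA + vB) does not vanish when Im z >= 0, Im w > 0
    and Im v >= 0 ([hlpm_cone_zero_free]). After multiplication by a suitable
    complex number, this says that the real zeros t of P(tI + M) are negative,
    and that the zeros s of P(M + s(A - B)/2) are real with s^2 > 1. Factoring
    the latter polynomial f then gives
    f(1) f(-1) = l^2 prod (s^2 - 1) <= l^2 prod s^2 = f(0)^2.

    The zero-free region is built one cone direction at a time
    ([upper_zero_free_cone]) by deforming P(zI + X + wA + Y), where X is real
    and Y is already known to be harmless, to P(zI + wA). When w is in the upper
    half plane the latter is nonzero because its factors are z + w lambda_i
    with lambda_i > 0. During the deformation a zero w could only enter the
    upper half plane through the real axis, where wA is a real matrix that can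
    be absorbed in X, so that there is no zero there. The Cayley transform turns
    the half plane into the unit disk, whose compactness yields the continuity
    argument [zero_free_homotopy]. *)

Set Implicit Arguments.
Unset Strict Implicit.
Unset Printing Implicit Defensive.

Import Order.TTheory GRing.Theory Num.Theory.
Local Open Scope ring_scope.
Local Open Scope complex_scope.

(** * Zeros of a family of polynomials in the unit disk *)

(** The bound on the values themselves is what makes the induction on p go
    through. *)
Lemma horner_lipschitz (C : numDomainType) (p : {poly C}) :
  exists2 K : C, 0 <= K & forall x y, `|x| <= 1 -> `|y| <= 1 ->
    `|p.[x]| <= K /\ `|p.[x] - p.[y]| <= K * `|x - y|.
Proof.
elim/poly_ind: p => [|p c [K K0 HK]].
  by exists 0 => // x y _ _; rewrite !horner0 subrr normr0 mul0r.
exists (K + K + `|c|) => [|x y hx hy]; first by rewrite !addr_ge0.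
have [bx dxy] := HK x y hx hy; rewrite !hornerMXaddC; split.
  apply: le_trans (ler_normD _ _) _; rewrite lerD2r normrM.
  by apply: le_trans (ler_pM _ _ bx hx) _; rewrite // mulr1 lerDl.
have -> : p.[x] * x + c - (p.[y] * y + c)
        = p.[x] * (x - y) + (p.[x] - p.[y]) * y by ring.
apply: le_trans (ler_normD _ _) _; rewrite !normrM 2!mulrDl -addrA.
apply: lerD; first exact: ler_wpM2r.
apply: le_trans (ler_pM _ _ dxy hy) _; rewrite // mulr1 lerDl.
exact: mulr_ge0.
Qed.

Lemma horner2_lipschitz (C : numDomainType) (Q : {poly {poly C}}) :
  exists2 K : C, 0 <= K & forall x y z,
    `|x| <= 1 -> `|y| <= 1 -> `|z| <= 1 ->
    `|Q.[z%:P].[x] - Q.[z%:P].[y]| <= K * `|x - y|.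
Proof.
elim/poly_ind: Q => [|Q c [K K0 HK]].
  by exists 0 => // x y z _ _ _; rewrite !horner0 subrr normr0 mul0r.
have [L L0 HL] := horner_lipschitz c.
exists (K + L) => [|x y z hx hy hz]; first exact: addr_ge0.
rewrite !hornerMXaddC !hornerD !hornerM !hornerC opprD addrACA -mulrBl.
apply: le_trans (ler_normD _ _) _; rewrite [leRHS]mulrDl; apply: lerD; last first.
  by have [] := HL x y hx hy.
rewrite normrM -[leRHS]mulr1; apply: ler_pM => //; exact: HK.
Qed.

Lemma zero_free_disk_factor (C : numClosedFieldType) (p : {poly C}) :
    (forall z, `|z| <= 1 -> p.[z] != 0) ->
  lead_coef p != 0 /\
  exists2 s, p = lead_coef p *: \prod_(z <- s) ('X - z%:P)
    & forall z, z \in s -> 1 < `|z|.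
Proof.
move=> p_nz; have [s Ds] := closed_field_poly_normal p; split.
  rewrite lead_coef_eq0; apply/eqP => p0.
  by have := p_nz 0; rewrite p0 normr0 ler01 horner0 eqxx => /(_ isT).
exists s => // z zs; rewrite real_ltNge ?real1 ?normr_real //.
apply/negP => /p_nz; rewrite Ds hornerZ horner_prod (big_rem z) //=.
by rewrite hornerXsubC subrr mul0r mulr0 eqxx.
Qed.

Lemma min_modulus_disk (C : numClosedFieldType) (p : {poly C}) :
    (forall z, `|z| <= 1 -> p.[z] != 0) ->
  exists2 m : C, 0 < m & forall z, `|z| <= 1 -> m <= `|p.[z]|.
Proof.
case/zero_free_disk_factor=> lc_nz [s Ds s_gt1].
exists (`|lead_coef p| * \prod_(x <- s) (`|x| - 1)).
  rewrite mulr_gt0 ?normr_gt0 // big_seq prodr_gt0 // => x /s_gt1.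
  by rewrite subr_gt0.
move=> z hz; rewrite {2}Ds hornerZ horner_prod normrM normr_prod.
apply: ler_wpM2l => //; rewrite big_seq [leRHS]big_seq; apply: ler_prod => x /s_gt1 xs.
rewrite subr_ge0 ltW //= hornerXsubC distrC.
by apply: le_trans (lerB_dist _ _); rewrite lerD2l lerN2.
Qed.

(** A Harnack inequality: a polynomial without zeros in the disk cannot be
    small inside the disk and large at 1. Each factor contributes
    |z - x| >= |x| - |z| >= (1 - |z|) / 2 * (1 + |x|), the second inequality
    being equivalent to (1 + |z|) (|x| - 1) >= 0. The constant depends only on
    a bound of the degree, so the inequality survives limits of polynomials. *)
Lemma disk_harnack (C : numClosedFieldType) (p : {poly C}) (N : nat) (z : C) :
    (forall x, `|x| <= 1 -> p.[x] != 0) -> (size p <= N.+1)%N -> `|z| < 1 ->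
  ((1 - `|z|) / 2) ^+ N * `|p.[1]| <= `|p.[z]|.
Proof.
case/zero_free_disk_factor=> lc_nz [s Ds s_gt1] szp hz.
have sz_s : (size s <= N)%N.
  by move: szp; rewrite Ds size_scale // size_prod_XsubC.
set b := (1 - `|z|) / 2.
have b0 : 0 < b by rewrite divr_gt0 ?subr_gt0.
have b1 : b <= 1.
  by rewrite ler_pdivrMr // mul1r lerBlDr (@le_trans _ _ 2) ?lerDl // ler1n.
apply: (@le_trans _ _ (b ^+ size s * `|p.[1]|)).
  by rewrite ler_wpM2r // ler_wiXn2l // ltW.
rewrite Ds !hornerZ !horner_prod !normrM mulrCA !normr_prod.
apply: ler_wpM2l => //.
have step x : 1 < `|x| -> b * `|('X - x%:P).[1]| <= `|('X - x%:P).[z]|.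
  move=> x1; rewrite !hornerXsubC.
  apply: (@le_trans _ _ (b * (1 + `|x|))).
    rewrite ler_wpM2l ?(ltW b0) //.
    by have := ler_normB 1 x; rewrite normr1.
  apply: (@le_trans _ _ (`|x| - `|z|)); last by rewrite distrC lerB_dist.
  rewrite -subr_ge0.
  have -> : `|x| - `|z| - b * (1 + `|x|) = (1 + `|z|) * (`|x| - 1) / 2.
    by rewrite /b; field.
  by rewrite divr_ge0 // mulr_ge0 ?subr_ge0 ?(ltW x1) // addr_ge0.
elim: s s_gt1 {Ds sz_s} => [|x s IHs] s_gt1; first by rewrite !big_nil mulr1.
rewrite !big_cons /= exprS mulrACA; apply: ler_pM.
- by rewrite mulr_ge0 // ltW.
- by rewrite mulr_ge0 ?prodr_ge0 // exprn_ge0 // ltW.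
- by apply: step; apply: s_gt1; rewrite inE eqxx.
by apply: IHs => y ys; apply: s_gt1; rewrite inE ys orbT.
Qed.

(** A continuous family of polynomials in z, none of which vanishes on the unit
    circle, cannot acquire a zero in the disk. The parameters r for which there
    is no zero form a set that is closed, because the Harnack inequality passes
    to the limit, and open in [0, 1], because the modulus is bounded below on
    the disk; so its supremum is 1. *)
Lemma zero_free_homotopy (R : realType) (Q : {poly {poly R[i]}}) :
    (forall (r : R) (z : R[i]), 0 <= r <= 1 -> `|z| = 1 -> Q.[z%:P].[r%:C] != 0) ->
    (forall z : R[i], `|z| <= 1 -> Q.[z%:P].[0] != 0) ->
  forall z : R[i], `|z| <= 1 -> Q.[z%:P].[1] != 0.
Proof.
move=> Q_bd Q_0.
pose F (r : R) (z : R[i]) := Q.[z%:P].[r%:C].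
pose S (r : R) : Prop := (0 <= r <= 1) /\ forall z : R[i], `|z| <= 1 -> F r z != 0.
have S0 : S 0 by split; rewrite ?lexx ?ler01.
have S1 : classical_sets.ubound S 1 by move=> r [/andP[]].
have supS : classical_sets.has_sup S by split; [exists 0 | exists 1].
pose p (r : R) := map_poly (horner_eval r%:C) Q.
have pE r z : (p r).[z] = F r z.
  by rewrite /F -[RHS](horner_map (horner_eval r%:C)) /= /horner_eval hornerC.
have sz_p r : (size (p r) <= (size Q).+1)%N.
  by apply: leq_trans (leqnSn _); apply: size_poly.
have [K0 K0_ge0 HK] := horner2_lipschitz Q.
have [K EK] : exists K : R, K0 = K%:C by apply/complex_realP/ger0_real.
have norm_le1 r : 0 <= r <= 1 -> `|r%:C| <= 1 :> R[i].
  by case/andP=> r0 r1; rewrite ger0_norm ?ler0c // -[leRHS]/(1%:C) lecR.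
have lipF r s z : 0 <= r <= 1 -> 0 <= s <= 1 -> `|z| <= 1 ->
    `|F r z - F s z| <= (K * `|r - s|)%:C.
  move=> hr hs hz; apply: le_trans (HK _ _ _ _ _ hz) _; rewrite ?norm_le1 //.
  rewrite EK rmorphM /= -rmorphB /= [`|(r - s)%:C|]normc_def /= expr0n addr0.
  by rewrite sqrtr_sqr.
have K_ge0 : 0 <= K by rewrite -ler0c -EK.
set b := sup S.
have b01 : 0 <= b <= 1.
  by rewrite ub_le_sup ?ge_sup //; [exists 0 | exists 1].
(* Closedness: the supremum itself is a parameter without zeros. *)
have Sb : S b.
  split=> // z; rewrite le_eqVlt => /orP[/eqP/Q_bd-> // | z1].
  apply/eqP => Fbz0.
  have Fb1 : 0 < `|F b 1| by rewrite normr_gt0 Q_bd ?normr1.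
  pose be := ((1 - `|z|) / 2) ^+ size Q.
  have be0 : 0 < be by rewrite exprn_gt0 // divr_gt0 ?subr_gt0.
  have [g Eg] : exists g : R, be * `|F b 1| = g%:C.
    by apply/complex_realP/ger0_real/ltW/mulr_gt0.
  have g0 : 0 < g by rewrite -ltcR -Eg mulr_gt0.
  have key r : S r -> g <= 2 * (K * `|r - b|).
    case=> r01 Fr; set L := K * `|r - b|.
    have F1 : `|F b 1| <= `|F r 1| + L%:C.
      rewrite -lerBlDl; apply: le_trans (lerB_dist _ _) _.
      by rewrite distrC lipF ?normr1.
    have Fz : `|F r z| <= L%:C.
      by have := lipF r b z r01 b01 (ltW z1); rewrite Fbz0 subr0.
    have be1 : be <= 1.
      rewrite exprn_ile1 // ?ler_pdivrMr // ?mul1r; last first.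
        by rewrite lerBlDr (@le_trans _ _ 2) ?lerDl // ler1n.
      by rewrite divr_ge0 // subr_ge0 ltW.
    have Hr : be * `|F r 1| <= `|F r z|.
      have := disk_harnack _ (sz_p r) z1; rewrite !pE; apply=> x hx.
      by rewrite pE; apply: Fr.
    rewrite -lecR -Eg; apply: le_trans (ler_wpM2l (ltW be0) F1) _.
    rewrite mulrDr mulrDl mul1r rmorphD lerD ?(le_trans Hr) //.
    by rewrite ler_piMl // ler0c mulr_ge0.
  have den : 0 < 2 * K + 1 by lra.
  have [r Sr rb] := sup_adherent (divr_gt0 g0 den) supS.
  have rb' : r <= b by apply: ub_le_sup => //; exists 1.
  have := key r Sr; rewrite ler0_norm ?subr_le0 // opprB.
  have : b - r < g / (2 * K + 1) by rewrite /b; lra.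
  rewrite ltr_pdivlMr // => h1 h2; move: h1 h2 rb'; clear; nra.
(* Openness: if b < 1, a slightly larger parameter has no zeros either. *)
have [b1|b1] := eqVneq b 1; first by case: Sb => _; rewrite b1.
have {}b1 : b < 1 by rewrite lt_neqAle b1; case/andP: b01.
exfalso.
have pb_nz z : `|z| <= 1 -> (p b).[z] != 0.
  by move=> hz; rewrite pE; case: Sb => _; apply.
have [m0 m0_gt0 Hm] := min_modulus_disk pb_nz.
have [m Em] : exists m : R, m0 = m%:C by apply/complex_realP/ger0_real/ltW.
have m_gt0 : 0 < m by rewrite -ltcR -Em.
pose r := Num.min 1 (b + m / (2 * K + 1)).
have den : 0 < 2 * K + 1 by lra.
have d_gt0 : 0 < m / (2 * K + 1) by rewrite divr_gt0.
have br : b < r by rewrite lt_min b1 ltrDl.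
have r01 : 0 <= r <= 1.
  by rewrite ge_min lexx andbT; apply: le_trans (ltW br); case/andP: b01.
suff Sr : S r by have := ub_le_sup (ex_intro _ 1 S1) Sr; rewrite -/b leNgt br.
split=> // z hz; apply/eqP => Frz0.
have := Hm z hz; rewrite pE -[F b z]subr0 -Frz0 => /le_trans/(_ (lipF _ _ _ b01 r01 hz)).
rewrite Em lecR distrC gtr0_norm ?subr_gt0 //.
have : r - b <= m / (2 * K + 1) by rewrite lerBlDl ge_min lexx orbT.
have : 0 < r - b by rewrite subr_gt0.
rewrite ler_pdivlMr //; move: K_ge0; clear; nra.
Qed.

(** * Homogeneous combinations of principal minors *)

(** Coefficients in an arbitrary commutative ring: the same expression is used
    over the reals, the complex numbers, and polynomials over these. *)
Definition hlpm (K : comNzRingType) (n k : nat) (c : {set 'I_n} -> K)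
    (X : 'M[K]_n) : K :=
  \sum_(J : {set 'I_n} | #|J| == k) c J * \det (principal_submx J X).

Local Notation cmx A := (map_mx (real_complex _) A).
Local Notation hlpmC k c := (hlpm k (fun J => (c J)%:C)).

Lemma hlpmZ (K : comNzRingType) n k (c : {set 'I_n} -> K) a X :
  hlpm k c (a *: X) = a ^+ k * hlpm k c X.
Proof.
rewrite /hlpm mulr_sumr; apply: eq_bigr => J /eqP Jk.
rewrite mulrCA; congr (_ * _).
have -> : principal_submx J (a *: X) = a *: principal_submx J X.
  by apply/matrixP=> i j; rewrite !mxE.
by rewrite detZ -Jk.
Qed.

Lemma rmorph_hlpm (K L : comNzRingType) (f : {rmorphism K -> L}) n k
    (c : {set 'I_n} -> K) X :
  f (hlpm k c X) = hlpm k (f \o c) (map_mx f X).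
Proof.
rewrite rmorph_sum; apply: eq_bigr => J _.
by rewrite rmorphM /principal_submx -map_mxsub det_map_mx.
Qed.

Lemma hlpm_cmx (R : rcfType) n k (c : {set 'I_n} -> R) X :
  hlpmC k c (cmx X) = (hlpm k c X)%:C.
Proof. by rewrite rmorph_hlpm. Qed.

Lemma hlpm_horner2 (K : comNzRingType) n k (c : {set 'I_n} -> K)
    (E : 'M[{poly {poly K}}]_n) (r z : K) :
  (hlpm k (polyC \o (polyC \o c)) E).[z%:P].[r]
  = hlpm k c (map_mx (fun q : {poly {poly K}} => q.[z%:P].[r]) E).
Proof.
rewrite -[LHS]/(horner_eval r (horner_eval z%:P _)) !rmorph_hlpm.
rewrite -map_mx_comp; apply: eq_bigr => J _; congr (_ * _).
by rewrite /= /horner_eval !hornerC.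
Qed.

(** Evaluating the same combination of minors on a matrix of polynomials. *)
Lemma hlpm_pencil (K : comNzRingType) n k (c : {set 'I_n} -> K) X Y :
  exists p : {poly K}, forall t, p.[t] = hlpm k c (X + t *: Y).
Proof.
exists (hlpm k (polyC \o c) (map_mx polyC X + 'X *: map_mx polyC Y)) => t.
rewrite -[LHS]/(horner_eval t _) rmorph_hlpm.
have -> : map_mx (horner_eval t) (map_mx polyC X + 'X *: map_mx polyC Y) = X + t *: Y.
  by apply/matrixP=> i j; rewrite !mxE /horner_eval !hornerE.
by apply: eq_bigr => J _; rewrite /= /horner_eval hornerC.
Qed.

Lemma poly_eq_nat (K : numDomainType) (p q : {poly K}) :
  (forall m : nat, p.[m%:R] = q.[m%:R]) -> p = q.
Proof.
move=> pq; apply/eqP; rewrite -subr_eq0; apply/eqP.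
apply: (@roots_geq_poly_eq0 _ _ [seq m%:R | m <- iota 0 (size (p - q))]).
- by apply/allP=> _ /mapP[m _ ->]; rewrite rootE !hornerE pq subrr.
- rewrite map_inj_uniq ?iota_uniq // => i j /eqP; rewrite eqr_nat.
  by move/eqP.
by rewrite size_map size_iota.
Qed.

(** Along the identity the minors are characteristic polynomials, which gives
    the exact degree and the leading coefficient. *)
Lemma hlpm_monic_pencil (K : comNzRingType) n k (c : {set 'I_n} -> K) X :
    hlpm k c 1%:M != 0 ->
  exists p : {poly K}, [/\ size p = k.+1, lead_coef p = hlpm k c 1%:M
    & forall t, p.[t] = hlpm k c (t%:M + X)].
Proof.
move=> P1.
pose p := \sum_(J : {set 'I_n} | #|J| == k)
  c J *: char_poly (- principal_submx J X).
have E1 : hlpm k c 1%:M = \sum_(J : {set 'I_n} | #|J| == k) c J.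
  apply: eq_bigr => J _; rewrite [principal_submx _ _](_ : _ = 1%:M) ?det1 ?mulr1 //.
  by apply/matrixP=> i j; rewrite !mxE (inj_eq enum_val_inj).
have szp : (size p <= k.+1)%N.
  apply: leq_trans (size_sum _ _ _) _; apply/bigmax_leqP => J /eqP Jk.
  by apply: leq_trans (size_scale_leq _ _) _; rewrite size_char_poly Jk.
have pk : p`_k = hlpm k c 1%:M.
  rewrite coef_sum E1; apply: eq_bigr => J /eqP Jk.
  have /monicP := char_poly_monic (- principal_submx J X).
  by rewrite lead_coefE size_char_poly /= coefZ -Jk => ->; rewrite mulr1.
have sz : size p = k.+1.
  apply/eqP; rewrite eqn_leq szp ltnNge; apply/negP => /leq_sizeP/(_ k (leqnn k)).
  by rewrite pk => /eqP; apply/negP.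
exists p; split; rewrite ?lead_coefE ?sz // => t.
rewrite horner_sum; apply: eq_bigr => J _; rewrite hornerZ; congr (_ * _).
rewrite -[LHS]/(horner_eval t _) -det_map_mx; congr (\det _).
apply/matrixP=> i j; rewrite !mxE /horner_eval (inj_eq enum_val_inj).
by rewrite /= /horner_eval hornerD hornerN hornerC hornerMn hornerX opprK.
Qed.

Lemma symmetricmxE (K : fieldType) n (A : 'M[K]_n) :
  (A \is symmetricmx) = (A^T == A).
Proof.
rewrite is_hermitianmxE expr0 scale1r eq_sym; congr (_ == _).
by apply/matrixP=> i j; rewrite !mxE.
Qed.

Lemma symmetricmxD (K : fieldType) n (A B : 'M[K]_n) :
  A \is symmetricmx -> B \is symmetricmx -> A + B \is symmetricmx.
Proof. by rewrite !symmetricmxE linearD /= => /eqP-> /eqP->. Qed.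

Lemma symmetricmxZ (K : fieldType) n (a : K) (A : 'M[K]_n) :
  A \is symmetricmx -> a *: A \is symmetricmx.
Proof. by rewrite !symmetricmxE linearZ /= => /eqP->. Qed.

Lemma symmetricmx_scalar (K : fieldType) n (a : K) :
  (a%:M : 'M[K]_n) \is symmetricmx.
Proof. by rewrite symmetricmxE tr_scalar_mx. Qed.

(** Both sides of P(aX) = a^k P(X) are polynomials in a; comparing their
    coefficients of degree k discards the minors of size other than k. *)
Lemma lpm_homogeneousP (R : realType) n k (P : 'M[R]_n -> R) :
    lpm_polynomial P -> homogeneous k P ->
  exists c, forall X, X \is symmetricmx -> P X = hlpm k c X.
Proof.
case=> c Pc hP; exists c => X Xsym.
pose p := \sum_(J : {set 'I_n}) (c J * \det (principal_submx J X)) *: 'X^#|J|.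
have Ep : p = P X *: 'X^k.
  apply: poly_eq_nat => m; rewrite horner_sum hornerZ hornerXn mulrC -hP //.
  rewrite Pc ?symmetricmxZ //.
  apply: eq_bigr => J _; rewrite hornerZ hornerXn -mulrA; congr (_ * _).
  rewrite [principal_submx J _ in RHS](_ : _ = m%:R *: principal_submx J X).
    by rewrite detZ mulrC.
  by apply/matrixP=> i j; rewrite !mxE.
have := congr1 (fun q : {poly R} => q`_k) Ep.
rewrite coefZ coefXn eqxx mulr1 => <-; rewrite coef_sum /hlpm [RHS]big_mkcond.
apply: eq_bigr => J _; rewrite coefZ coefXn eq_sym.
by case: eqP => _; rewrite ?mulr1 ?mulr0.
Qed.

(** * A zero-free region for the complex extension *)

(** For Y = 0 this is hyperbolicity; it says in general that the direction Y can
    be added without creating zeros in the upper half plane. *)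
Definition upper_zero_free (R : realType) (n k : nat) (c : {set 'I_n} -> R)
    (Y : 'M[R[i]]_n) : Prop :=
  forall (z : R[i]) (X : 'M[R]_n), 0 < complex.Im z -> X \is symmetricmx ->
    hlpmC k c (z%:M + cmx X + Y) != 0.

Lemma Im_real (R : rcfType) (w : R[i]) : complex.Im w = 0 -> w = (complex.Re w)%:C.
Proof. by case: w => a b /= ->. Qed.

Lemma hyperbolic_upper_zero_free (R : realType) n k (c : {set 'I_n} -> R) :
  hyperbolic (hlpm k c) -> upper_zero_free k c 0.
Proof.
case=> _ hyp z X z_gt0 Xsym; have [p [Ep p_real]] := hyp X Xsym.
have [q Eq] := hlpm_pencil k (fun J => (c J)%:C) (cmx X) 1%:M.
have Epq : map_poly (real_complex R) p = q.
  apply: poly_eq_nat => m; rewrite Eq -[in LHS](rmorph_nat (real_complex R)).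
  rewrite horner_map Ep /= -hlpm_cmx; congr (hlpm _ _ _).
  by rewrite map_mxD map_scalar_mx addrC rmorph_nat scale_scalar_mx mulr1.
apply/eqP => P0; have : root (map_poly (real_complex R) p) z.
  by rewrite rootE Epq Eq scale_scalar_mx mulr1 addrC -[_ + _]addr0 P0.
by move/p_real; case: z z_gt0 {P0} => a b /=; rewrite complex_real => /gt_eqF->.
Qed.

(** The eigenvalues of A factor P on the whole complex plane spanned by I and A,
    by homogeneity and because a polynomial is determined by its values at the
    natural numbers. *)
Lemma hlpm_cone_plane (R : realType) n k (c : {set 'I_n} -> R) A
    (lam : 'I_k -> R) (a b : R[i]) :
    hyperbolic_eigenvalues (hlpm k c) A lam ->
  hlpmC k c (a%:M + b *: cmx A)
  = (hlpm k c 1%:M)%:C * \prod_(i < k) (a + b * (lam i)%:C).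
Proof.
move=> eigA; have [-> | b_nz] := eqVneq b 0.
  rewrite scale0r addr0 -[a]mulr1 -scale_scalar_mx hlpmZ mulrC.
  rewrite -(map_scalar_mx (real_complex R)) hlpm_cmx; congr (_ * _).
  by under eq_bigr do rewrite mul0r addr0 mulr1; rewrite prodr_const card_ord.
have [q Eq] := hlpm_pencil k (fun J => (c J)%:C) (cmx A) 1%:M.
have Eq' : q = (hlpm k c 1%:M)%:C%:P * \prod_(i < k) ('X + (lam i)%:C%:P).
  apply: poly_eq_nat => m; rewrite Eq hornerM hornerC horner_prod.
  rewrite scale_scalar_mx mulr1 -(rmorph_nat (real_complex R)).
  rewrite -(map_scalar_mx (real_complex R)) -map_mxD hlpm_cmx addrC eigA.
  rewrite rmorphM rmorph_prod; congr (_ * _); apply: eq_bigr => i _.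
  by rewrite hornerD hornerX hornerC rmorphD.
have -> : a%:M + b *: cmx A = b *: (cmx A + (a / b) *: 1%:M).
  by rewrite scalerDr scalerA mulrC divfK // scale_scalar_mx mulr1 addrC.
rewrite hlpmZ -Eq Eq' hornerM hornerC horner_prod mulrCA; congr (_ * _).
rewrite -[X in _ ^+ X](card_ord k) -prodr_const -big_split; apply: eq_bigr => i _.
by rewrite hornerD hornerX hornerC /= mulrDr mulrC divfK.
Qed.

(** The map z |-> (w - conj w * z) / (1 - z) sends 0 to w and the unit disk
    to the half plane that contains w. *)
Lemma cayley_real (R : rcfType) (w z : R[i]) : `|z| = 1 -> z != 1 ->
  complex.Im ((w - conjc w * z) / (1 - z)) = 0.
Proof.
move=> z1 zn1; have zz : z * conjc z = 1 by rewrite -sqr_normc z1 expr1n.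
have d_nz : 1 - z != 0 by rewrite subr_eq0 eq_sym.
set u := _ / _; suff : conjc u = u.
  by case: u => a b [] /= /eqP; rewrite -subr_eq0 -opprD oppr_eq0 -mulr2n mulrn_eq0 /= => /eqP.
have -> : conjc u = (conjc w - w * conjc z) / (1 - conjc z).
  by rewrite /u rmorphM fmorphV !rmorphB rmorphM rmorph1 /= conjcK.
apply/eqP; rewrite eqr_div //; last by rewrite -conjc1 -rmorphB conjc_eq0.
rewrite -subr_eq0.
have -> : (conjc w - w * conjc z) * (1 - z) - (w - conjc w * z) * (1 - conjc z)
   = (w - conjc w) * (z * conjc z - 1) by ring.
by rewrite zz subrr mulr0.
Qed.

(** If z and w are in the upper half plane then z + l w is strictly longer than
    z + l (conj w), so their quotient is not in the unit disk. *)
Lemma cayley_pencil_neq0 (R : rcfType) (l : R) (z w x : R[i]) :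
    0 < complex.Im z -> 0 < complex.Im w -> 0 < l -> `|x| <= 1 ->
  (1 - x) * z + (w - conjc w * x) * l%:C != 0.
Proof.
move=> z0 w0 l0 x1; apply/eqP => E.
have {}E : z + w * l%:C = x * (z + conjc w * l%:C).
  by apply/eqP; rewrite -subr_eq0 -E; apply/eqP; ring.
have : `|z + w * l%:C| <= `|z + conjc w * l%:C|.
  by rewrite E normrM ler_piMl.
rewrite -(@ler_pXn2r _ 2) ?nnegrE // -!add_Re2_Im2 lecR.
case: z z0 {E} => a b /= b0; case: w w0 => p q /= q0.
have := mulr_gt0 l0 (mulr_gt0 b0 q0); nra.
Qed.

(** The deformation r |-> P(zI + r(X + Y) + w'A) from r = 0 to r = 1, where
    w' = (w - conj w * x) / (1 - x) with x in the unit disk, and the denominator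
    is cleared by homogeneity. The value to be shown nonzero is at r = 1 and
    x = 0. On the circle w' is real, or infinite when x = 1. *)
Lemma upper_zero_free_cone (R : realType) n k (c : {set 'I_n} -> R)
    (A : 'M[R]_n) (w : R[i]) (Y : 'M[R[i]]_n) :
    0 < hlpm k c 1%:M ->
    hyperbolicity_cone k (hlpm k c) A ->
    (forall r : R, 0 <= r <= 1 -> upper_zero_free k c (r%:C *: Y)) ->
    0 <= complex.Im w ->
  upper_zero_free k c (w *: cmx A + Y).
Proof.
move=> P1 [Asym [lam [eigA lam0]]] HY; rewrite le_eqVlt => /orP[/eqP w0|w0] z X z0 Xsym.
  rewrite (Im_real (esym w0)) -map_mxZ addrA -(addrA _ _ (cmx _)) -map_mxD.
  rewrite -[Y]scale1r -[1]/(1%:C); apply: HY => //; first by rewrite ler01 lexx.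
  by rewrite symmetricmxD ?symmetricmxZ.
(* The outer variable 'X stands for x, the inner one for r. *)
pose io (a : R[i]) : {poly {poly R[i]}} := a%:P%:P.
pose E : 'M[{poly {poly R[i]}}]_n :=
  (1 - 'X) *: (map_mx io z%:M + ('X)%:P *: map_mx io (cmx X + Y))
  + (io w - io (conjc w) * 'X) *: map_mx io (cmx A).
pose Q := hlpm k (polyC \o (polyC \o (fun J => (c J)%:C))) E.
have EQ (r x : R[i]) : Q.[x%:P].[r]
   = hlpmC k c ((1 - x) *: (z%:M + r *: (cmx X + Y)) + (w - conjc w * x) *: cmx A).
  rewrite hlpm_horner2; congr (hlpm _ _ _); apply/matrixP => i j.
  by rewrite !mxE /io !hornerE.
have := @zero_free_homotopy R Q _ _ 0; rewrite normr0 EQ.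
rewrite !subr0 mulr0 subr0 !scale1r -!addrA (addrC Y); apply=> //; last first.
  move=> x x1; rewrite EQ scale0r addr0 scale_scalar_mx (hlpm_cone_plane _ _ eigA).
  rewrite mulf_neq0 //; first by rewrite (inj_eq (@complexI _) _ 0) gt_eqF.
  by apply/prodf_neq0 => i _; apply: cayley_pencil_neq0.
move=> r x r01 x1; rewrite EQ.
(* At x = 1 only (w - conj w) A remains. *)
have [-> | xn1] := eqVneq x 1.
  rewrite subrr scale0r -(raddf0 (@scalar_mx R[i] n)) (hlpm_cone_plane _ _ eigA).
  rewrite mulf_neq0 //; first by rewrite (inj_eq (@complexI _) _ 0) gt_eqF.
  apply/prodf_neq0 => i _; rewrite add0r mulr1 mulf_neq0 //; last first.
    by rewrite (inj_eq (@complexI _) _ 0) gt_eqF.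
  rewrite subcJ !mulf_neq0 ?pnatr_eq0 //.
    by rewrite (inj_eq (@complexI _) _ 0) gt_eqF.
  by rewrite eq_complex /= oner_eq0 andbF.
have d_nz : 1 - x != 0 by rewrite subr_eq0 eq_sym.
set u := (w - conjc w * x) / (1 - x).
have u_real : complex.Im u = 0 by apply: cayley_real.
have -> : w - conjc w * x = (1 - x) * u by rewrite [RHS]mulrC /u divfK.
rewrite -scalerA -scalerDr hlpmZ mulf_neq0 ?expf_neq0 //.
have -> : z%:M + r%:C *: (cmx X + Y) + u *: cmx A
        = z%:M + cmx (r *: X + complex.Re u *: A) + r%:C *: Y.
  rewrite [in LHS](Im_real u_real) map_mxD !map_mxZ scalerDr -!addrA.
  by congr (_ + (_ + _)); rewrite addrC.
by apply: HY => //; rewrite symmetricmxD ?symmetricmxZ.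
Qed.

Lemma hyperbolicity_cone_shrink (R : realType) n k (P : 'M[R]_n -> R) A :
    hyperbolicity_cone k P A ->
  exists2 e : R, 0 < e & hyperbolicity_cone k P (A - e%:M).
Proof.
case=> Asym [lam [eigA lam0]].
pose m := \big[Num.min/1]_(i < k) lam i.
have m0 : 0 < m by apply: lt_bigmin.
have m2 : 0 < m / 2 by rewrite divr_gt0.
exists (m / 2) => //; split.
  by rewrite symmetricmxD // -scaleN1r symmetricmxZ // symmetricmx_scalar.
exists (fun i => lam i - m / 2); split => [t | i].
  have -> : t%:M + (A - (m / 2)%:M) = (t - m / 2)%:M + A.
    by rewrite raddfB /= addrA addrAC.
  by rewrite eigA; congr (_ * _); apply: eq_bigr => i _; ring.
have : m <= lam i by apply: bigmin_le_cond.
lra.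
Qed.

(** Adding the directions vB and wA one after the other needs Im z > 0. The
    boundary case Im z = 0 is reached by writing A = A' + eI with A' still in
    the cone: w e is then moved into z. *)
Lemma hlpm_cone_zero_free (R : realType) n k (c : {set 'I_n} -> R) A B
    (z w v : R[i]) :
    hyperbolic (hlpm k c) ->
    hyperbolicity_cone k (hlpm k c) A -> hyperbolicity_cone k (hlpm k c) B ->
    0 <= complex.Im z -> 0 < complex.Im w -> 0 <= complex.Im v ->
  hlpmC k c (z%:M + w *: cmx A + v *: cmx B) != 0.
Proof.
move=> hyp /hyperbolicity_cone_shrink[e e0 coneA] coneB z0 w0 v0.
have [P1 _] := hyp.
have uzfB (r : R) : 0 <= r <= 1 -> upper_zero_free k c (r%:C *: (v *: cmx B)).
  case/andP=> r0 _; rewrite scalerA -[X in upper_zero_free _ _ X]addr0.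
  apply: upper_zero_free_cone => // [s _|].
    by rewrite scaler0; apply: hyperbolic_upper_zero_free.
  by case: v v0 => p q /= q0; rewrite mul0r addr0 mulr_ge0.
have zw0 : 0 < complex.Im (z + w * e%:C).
  case: z w z0 w0 => [a b] [p q] /= b0 q0.
  by rewrite mulr0 add0r ltr_wpDl // mulr_gt0.
have := upper_zero_free_cone P1 coneA uzfB (ltW w0) zw0 (symmetricmx_scalar n 0).
rewrite (_ : _ + _ = z%:M + w *: cmx A + v *: cmx B) //.
rewrite raddf0 map_mx0 addr0 addrA; congr (_ + _).
rewrite map_mxB map_scalar_mx raddfD /= scalerBr scale_scalar_mx -addrA.
by rewrite [X in _ + X]addrC subrK.
Qed.

(** * Midpoints in the hyperbolicity cone *)

Lemma hyperbolicity_cone_roots (R : realType) n k (c : {set 'I_n} -> R) X :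
    0 < hlpm k c 1%:M -> X \is symmetricmx ->
    (forall z : R[i], hlpmC k c (z%:M + cmx X) = 0 ->
       complex.Im z = 0 /\ complex.Re z < 0) ->
  hyperbolicity_cone k (hlpm k c) X.
Proof.
move=> P1 Xsym rootsX; split=> //.
have PC1 : hlpmC k c 1%:M = (hlpm k c 1%:M)%:C.
  by rewrite -(map_scalar_mx (real_complex R)) hlpm_cmx.
have [|p [szp lcp Ep]] := @hlpm_monic_pencil _ n k (fun J => (c J)%:C) (cmx X).
  by rewrite PC1 (inj_eq (@complexI _) _ 0) gt_eqF.
have [s Ds] := closed_field_poly_normal p.
have lc_nz : lead_coef p != 0 by rewrite lead_coef_eq0 -size_poly_gt0 szp.
have sz_s : size s = k by move: szp; rewrite Ds size_scale // size_prod_XsubC => -[].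
have roots_s z : z \in s -> complex.Im z = 0 /\ complex.Re z < 0.
  move=> zs; apply: rootsX; rewrite -Ep Ds hornerZ horner_prod (big_rem z) //=.
  by rewrite hornerXsubC subrr mul0r mulr0.
exists (fun i => - complex.Re s`_i); split => [t | i]; last first.
  by rewrite oppr_gt0; apply: (roots_s _ _).2; rewrite mem_nth // sz_s.
apply: (@complexI R); rewrite -hlpm_cmx map_mxD map_scalar_mx -Ep Ds hornerZ.
rewrite lcp PC1 rmorphM horner_prod (big_nth 0) big_mkord sz_s rmorph_prod.
congr (_ * _); apply: eq_bigr => i _; rewrite hornerXsubC rmorphD rmorphN /=.
by congr (_ - _); apply: Im_real; apply: (roots_s _ _).1; rewrite mem_nth // sz_s.
Qed.

(** M + sN, with M = (A + B) / 2 and N = (A - B) / 2, equals wA + vB with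
    w = (1 + s) / 2 and v = (1 - s) / 2. By homogeneity, s is not a zero as soon
    as some rotation puts w and v in the closed upper half plane, at least one
    of them in its interior. Since w + v = 1, this fails only when w and v are
    nonzero real numbers of opposite signs, that is, when s is real and
    s^2 > 1. *)
Lemma hlpm_cone_segment_roots (R : realType) n k (c : {set 'I_n} -> R) A B
    (s : R[i]) :
    hyperbolic (hlpm k c) ->
    hyperbolicity_cone k (hlpm k c) A -> hyperbolicity_cone k (hlpm k c) B ->
    hlpmC k c (cmx (2^-1 *: (A + B)) + s *: cmx (2^-1 *: (A - B))) = 0 ->
  1 < s ^+ 2.
Proof.
move=> hyp coneA coneB f0.
have rot (a w v : R[i]) : a != 0 -> w = a * ((1 + s) / 2) -> v = a * ((1 - s) / 2) ->
    hlpmC k c (0%:M + w *: cmx A + v *: cmx B) = 0.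
  move=> a_nz -> ->.
  have -> : 0%:M + (a * ((1 + s) / 2)) *: cmx A + (a * ((1 - s) / 2)) *: cmx B
     = a *: (cmx (2^-1 *: (A + B)) + s *: cmx (2^-1 *: (A - B))).
    rewrite raddf0 add0r; apply/matrixP=> i j; rewrite !mxE !rmorphM fmorphV.
    by rewrite rmorph_nat rmorphD rmorphB /=; field.
  by rewrite hlpmZ f0 mulr0.
have nonzero (w v : R[i]) : 0 < complex.Im w -> 0 <= complex.Im v ->
    hlpmC k c (0%:M + w *: cmx A + v *: cmx B) != 0.
  by move=> w0 v0; apply: hlpm_cone_zero_free.
have nonzero' (w v : R[i]) : 0 <= complex.Im w -> 0 < complex.Im v ->
    hlpmC k c (0%:M + w *: cmx A + v *: cmx B) != 0.
  by move=> w0 v0; rewrite addrAC; apply: hlpm_cone_zero_free.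
(* For s not real, multiply by conj v or its opposite, which makes v real. *)
have s_real : complex.Im s = 0.
  apply/eqP; apply: contraT => s_im.
  have d_nz : 1 - s != 0.
    by rewrite subr_eq0; apply: contraNneq s_im => <-.
  have imw : complex.Im (conjc (1 - s) * (1 + s)) = 2 * complex.Im s.
    by case: s {f0 rot s_im d_nz} => x y /=; ring.
  have imv : complex.Im (conjc (1 - s) * (1 - s)) = 0.
    by case: s {f0 rot s_im d_nz imw} => x y /=; ring.
  have ImN (x : R[i]) : complex.Im (- x) = - complex.Im x by case: x.
  case: (ltgtP (complex.Im s) 0) s_im => // s_im _.
  - have := @nonzero (- (conjc (1 - s) * (1 + s))) (- (conjc (1 - s) * (1 - s))).
    rewrite !ImN imw imv oppr0 lexx oppr_gt0 pmulr_rlt0 // s_im => /(_ isT isT).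
    rewrite (rot (- 2 * conjc (1 - s))) ?eqxx //; try by field.
    by rewrite mulf_neq0 ?oppr_eq0 ?pnatr_eq0 // conjc_eq0.
  have := @nonzero (conjc (1 - s) * (1 + s)) (conjc (1 - s) * (1 - s)).
  rewrite imw imv lexx pmulr_rgt0 // s_im => /(_ isT isT).
  rewrite (rot (2 * conjc (1 - s))) ?eqxx //; try by field.
  by rewrite mulf_neq0 ?pnatr_eq0 // conjc_eq0.
rewrite (Im_real s_real) -rmorphXn -[1]/(1%:C) ltcR ltNge; apply/negP => a1.
(* For s real in [-1, 1], multiplication by i makes w and v purely imaginary
   with nonnegative imaginary parts, of which one is positive. *)
have {}rot : hlpmC k c (0%:M + ('i * (1 + s)) *: cmx A + ('i * (1 - s)) *: cmx B) = 0.
  apply: (rot (2 * 'i)); try by field.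
  by rewrite mulf_neq0 ?pnatr_eq0 // eq_complex /= oner_eq0 andbF.
have imw : complex.Im ('i * (1 + s)) = 1 + complex.Re s.
  by rewrite mulrC ImiRe; case: (s).
have imv : complex.Im ('i * (1 - s)) = 1 - complex.Re s.
  by rewrite mulrC ImiRe; case: (s).
have v0 : 0 <= 1 - complex.Re s by nra.
have w0 : 0 <= 1 + complex.Re s by nra.
have [wp | wp] := ltrP 0 (1 + complex.Re s).
  by have := nonzero ('i * (1 + s)) ('i * (1 - s)); rewrite imw imv rot eqxx => /(_ wp v0).
have vp : 0 < 1 - complex.Re s by lra.
by have := nonzero' ('i * (1 + s)) ('i * (1 - s)); rewrite imw imv rot eqxx => /(_ w0 vp).
Qed.

(** The inequality is the logarithmic form of Garding's concavity. It holds
    because the restriction f of P to the line through A and B, with its origin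
    at the midpoint, has real zeros outside [-1, 1]; compare
    f(1) f(-1) and f(0)^2 factor by factor. *)
Lemma hlpm_cone_midpoint (R : realType) n k (c : {set 'I_n} -> R) A B :
    hyperbolic (hlpm k c) ->
    hyperbolicity_cone k (hlpm k c) A -> hyperbolicity_cone k (hlpm k c) B ->
  hyperbolicity_cone k (hlpm k c) (2^-1 *: (A + B)) /\
  hlpm k c A * hlpm k c B <= hlpm k c (2^-1 *: (A + B)) ^+ 2.
Proof.
move=> hyp coneA coneB; have [P1 _] := hyp.
have [Asym _] := coneA; have [Bsym _] := coneB.
have Msym : 2^-1 *: (A + B) \is symmetricmx by rewrite symmetricmxZ ?symmetricmxD.
split.
  apply: hyperbolicity_cone_roots => // z Pz0.
  have uzf := hyperbolic_upper_zero_free hyp.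
  have z_real : complex.Im z = 0.
    apply/eqP; apply: contraT => z_im.
    case: (ltgtP (complex.Im z) 0) z_im => // z_im _.
    - have Nz_im : 0 < complex.Im (- z).
        by case: (z) z_im => x y /=; rewrite oppr_gt0.
      have := uzf _ _ Nz_im (symmetricmxZ (-1) Msym); rewrite addr0.
      rewrite scaleN1r map_mxN raddfN -opprD -scaleN1r.
      by rewrite hlpmZ Pz0 mulr0 eqxx.
    by have := uzf z _ z_im Msym; rewrite addr0 Pz0 eqxx.
  split=> //; rewrite ltNge; apply/negP => z_ge0.
  (* For z >= 0, multiply zI + A/2 + B/2 by i. *)
  have := @hlpm_cone_zero_free _ n k c A B ('i * z) ('i / 2) ('i / 2) hyp coneA coneB.
  have -> : ('i * z)%:M + ('i / 2) *: cmx A + ('i / 2) *: cmx B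
     = 'i *: (z%:M + cmx (2^-1 *: (A + B))) :> 'M[R[i]]_n.
    rewrite -addrA -scalerDr -map_mxD scalerDr scale_scalar_mx; congr (_ + _).
    by rewrite map_mxZ scalerA fmorphV rmorph_nat.
  rewrite hlpmZ Pz0 mulr0 eqxx.
  rewrite mulrC ImiRe mulrC ImiRe.
  have : complex.Re (2^-1 : R[i]) = 2^-1.
    by rewrite -(rmorph_nat (real_complex R)) -fmorphV.
  by move=> ->; rewrite z_ge0 invr_gt0 ltr0n invr_ge0 ler0n => /(_ isT isT isT).
have [q Eq] := hlpm_pencil k (fun J => (c J)%:C) (cmx (2^-1 *: (A + B))) (cmx (2^-1 *: (A - B))).
have [s Ds] := closed_field_poly_normal q.
move: (lead_coef q) Ds => l Ds.
have roots_s z : z \in s -> 1 < z ^+ 2.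
  move=> zs; apply: (hlpm_cone_segment_roots hyp coneA coneB).
  rewrite -Eq Ds hornerZ horner_prod (big_rem z) //=.
  by rewrite hornerXsubC subrr mul0r mulr0.
have q1 : q.[1] = (hlpm k c A)%:C.
  rewrite Eq scale1r -map_mxD hlpm_cmx; congr ((hlpm _ _ _)%:C).
  by apply/matrixP=> i j; rewrite !mxE; field.
have qN1 : q.[-1] = (hlpm k c B)%:C.
  rewrite Eq scaleN1r -map_mxN -map_mxD hlpm_cmx; congr ((hlpm _ _ _)%:C).
  by apply/matrixP=> i j; rewrite !mxE; field.
have q0 : q.[0] = (hlpm k c (2^-1 *: (A + B)))%:C.
  by rewrite Eq scale0r addr0 hlpm_cmx.
have prod_gt0 : 0 < \prod_(z <- s) z ^+ 2.
  by rewrite big_seq prodr_gt0 // => z /roots_s; apply: lt_trans.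
have q0sq : q.[0] ^+ 2 = l ^+ 2 * \prod_(z <- s) z ^+ 2.
  rewrite Ds hornerZ horner_prod exprMn prodrXl; congr (_ * _).
  rewrite -!prodrXl; apply: eq_bigr => z _; rewrite hornerXsubC; ring.
have lc2 : 0 <= l ^+ 2.
  rewrite -(pmulr_lge0 _ prod_gt0) -q0sq q0 -rmorphXn ler0c; exact: sqr_ge0.
rewrite -lecR rmorphM rmorphXn /= -q1 -qN1 -q0 q0sq.
rewrite Ds !hornerZ !horner_prod mulrACA -expr2 -big_split.
rewrite ler_wpM2l // big_seq [leRHS]big_seq; apply: ler_prod => z /roots_s z1.
rewrite /= !hornerXsubC.
have -> : (1 - z) * (-1 - z) = z ^+ 2 - 1 by ring.
by rewrite subr_ge0 ltW //= lerBlDr lerDl ler01.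
Qed.

(** * Pinchings as iterated midpoints *)

(** Conjugation by the diagonal matrix with entries -1 on S and 1 elsewhere. *)
Definition sign_flip (R : pzRingType) n (S : {set 'I_n}) (A : 'M[R]_n) : 'M[R]_n :=
  \matrix_(i, j) ((-1) ^+ (i \in S) * A i j * (-1) ^+ (j \in S)).

Definition split_pinching (R : pzRingType) n (S : {set 'I_n}) (A : 'M[R]_n) : 'M[R]_n :=
  \matrix_(i, j) (if (i \in S) == (j \in S) then A i j else 0).

Lemma hlpm_sign_flip (K : comNzRingType) n k (c : {set 'I_n} -> K) S A :
  hlpm k c (sign_flip S A) = hlpm k c A.
Proof.
apply: eq_bigr => J _; congr (_ * _).
pose d : 'rV[K]_#|J| := \row_i (-1) ^+ (@enum_val _ (mem J) i \in S).
have -> : principal_submx J (sign_flip S A)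
        = diag_mx d *m principal_submx J A *m diag_mx d.
  by rewrite mul_mx_diag mul_diag_mx; apply/matrixP => i j; rewrite !mxE.
rewrite !det_mulmx mulrAC det_diag -big_split big1 ?mul1r // => i _ /=.
by rewrite mxE -signr_addb addbb.
Qed.

Lemma split_pinchingE (K : numFieldType) n S (A : 'M[K]_n) :
  split_pinching S A = 2^-1 *: (A + sign_flip S A).
Proof.
apply/matrixP=> i j; rewrite !mxE.
by case: (i \in S); case: (j \in S); rewrite /= ?expr0 ?expr1; field.
Qed.

(** The midpoint inequality between A and its sign flip, at which P takes the
    same value. *)
Lemma hlpm_split_pinching (R : realType) n k (c : {set 'I_n} -> R) S A :
    hyperbolic (hlpm k c) -> hyperbolicity_cone k (hlpm k c) A ->
  hyperbolicity_cone k (hlpm k c) (split_pinching S A) /\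
  hlpm k c A <= hlpm k c (split_pinching S A).
Proof.
move=> hyp coneA; have [P1 _] := hyp.
have posP X : hyperbolicity_cone k (hlpm k c) X -> 0 < hlpm k c X.
  case=> _ [lam [eigX lam0]]; have := eigX 0; rewrite raddf0 add0r => ->.
  by rewrite mulr_gt0 // prodr_gt0 // => i _; rewrite add0r.
have coneB : hyperbolicity_cone k (hlpm k c) (sign_flip S A).
  have [Asym [lam [eigA lam0]]] := coneA; split.
    move: Asym; rewrite !symmetricmxE => /eqP/matrixP Asym; apply/eqP/matrixP => i j.
    by rewrite !mxE -[A i j]Asym mxE; ring.
  exists lam; split=> // t; rewrite -eigA -[RHS](hlpm_sign_flip _ _ S).
  congr (hlpm _ _ _); apply/matrixP=> i j; rewrite !mxE mulrDr mulrDl; congr (_ + _).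
  case: eqP => [->|_]; last by rewrite mulr0n mulr0 mul0r.
  by rewrite mulrAC -signr_addb addbb mul1r.
have [coneM PM] := hlpm_cone_midpoint hyp coneA coneB.
rewrite split_pinchingE; split=> //.
move: PM; rewrite hlpm_sign_flip -expr2 ler_pXn2r // nnegrE ltW //; exact: posP.
Qed.

(** Two indices are in the same block exactly when no block separates them. *)
Lemma pinching_foldr (R : realType) n (Pi : {set {set 'I_n}}) (A : 'M[R]_n) :
  partition Pi [set: 'I_n] ->
  pinching Pi A = foldr (fun S B => split_pinching S B) A (enum Pi).
Proof.
move=> /and3P[/eqP cov triv _].
have foldrE (s : seq {set 'I_n}) i j :
    foldr (fun S B => split_pinching S B) A s i j
    = if all (fun S : {set 'I_n} => (i \in S) == (j \in S)) s then A i j else 0.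
  elim: s => //= S s IHs; rewrite mxE IHs.
  by case: (_ == _) => //=.
apply/matrixP=> i j; rewrite foldrE mxE; congr (if _ then _ else _).
apply/exists_inP/allP => [[S SPi /andP[iS jS]] T | same].
  rewrite mem_enum => TPi; apply/eqP; apply/idP/idP => xT.
    by rewrite -(def_pblock triv TPi xT) (def_pblock triv SPi iS).
  by rewrite -(def_pblock triv TPi xT) (def_pblock triv SPi jS).
have iPi : i \in cover Pi by rewrite cov inE.
exists (pblock Pi i); first exact: pblock_mem.
have := same (pblock Pi i); rewrite mem_enum pblock_mem // => /(_ isT)/eqP <-.
by rewrite mem_pblock iPi.
Qed.

Theorem theorem3p14 (R : realType) (n k : nat) (P : 'M[R]_n -> R)
    (P_lpm : lpm_polynomial P) (P_hom : homogeneous k P)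
    (P_hyp : hyperbolic P)
    (Pi : {set {set 'I_n}}) (Pi_part : partition Pi [set: 'I_n])
    (A : 'M[R]_n) (A_cone : hyperbolicity_cone k P A) :
  hyperbolicity_cone k P (pinching Pi A) /\ P A <= P (pinching Pi A).
Proof.
have [c Pc] := lpm_homogeneousP P_lpm P_hom.
have symD t X : X \is symmetricmx -> t%:M + X \is symmetricmx.
  by move=> Xsym; rewrite symmetricmxD ?symmetricmx_scalar.
have hyp : hyperbolic (hlpm k c).
  have [P1 hyp] := P_hyp; split; first by rewrite -Pc ?symmetricmx_scalar.
  move=> X Xsym; have [p [Ep p_real]] := hyp X Xsym; exists p; split=> // t.
  by rewrite Ep Pc ?symD.
have coneE X : hyperbolicity_cone k P X <-> hyperbolicity_cone k (hlpm k c) X.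
  by split=> -[Xsym [lam [eigX lam0]]]; split=> //; exists lam; split=> // t;
     have := eigX t; rewrite !Pc ?symmetricmx_scalar ?symD.
rewrite pinching_foldr //; move/coneE: A_cone => A_cone.
suff [coneM PM] : hyperbolicity_cone k (hlpm k c)
      (foldr (fun S B => split_pinching S B) A (enum Pi)) /\
    hlpm k c A <= hlpm k c (foldr (fun S B => split_pinching S B) A (enum Pi)).
  split; first exact/coneE.
  by have [Asym _] := A_cone; have [Msym _] := coneM; rewrite !Pc.
elim: (enum Pi) => [|S s [coneB PB]] //=.
have [coneS PS] := hlpm_split_pinching S hyp coneB.
by split=> //; apply: le_trans PS.
Qed.
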